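(* Let $I_1,I_2\subset\mathbf{R}$ be open intervals, let $\gamma=(\gamma_1,\gamma_2):I_1\to S^3$ be a unit speed Legendre curve in $S^3$ and $\alpha=(\alpha_1,\alpha_2):I_2\to H^3_1$ a unit speed Legendre curve in $H^3_1$, such that the map $$\phi:I_2\times I_1\to\mathbf{C}^2,\qquad \phi(t,s)=(\alpha_1(t)\gamma_1(s),\,\alpha_2(t)\gamma_2(s)),$$ is a (Lagrangian conformal) immersion. Then $\phi$ has parallel non-null (i.e. nonzero) mean curvature vector if and only if $|\gamma_1|$ and $|\alpha_1|$ are constant.
   Context: Curves are smooth. $S^3=\{(z,w)\in\mathbf{C}^2:|z|^2+|w|^2=1\}$. A unit speed Legendre curve $\gamma$ in $S^3$ satisfies $|\gamma_1|^2+|\gamma_2|^2=1$, $|\gamma_1'|^2+|\gamma_2'|^2=1$, $\gamma_1'\bar\gamma_1+\gamma_2'\bar\gamma_2=0$. $H^3_1=\{(z,w)\in\mathbf{C}^2:|z|^2-|w|^2=-1\}$. A unit speed Legendre curve $\alpha$ in $H^3_1$ satisfies $|\alpha_1|^2-|\alpha_2|^2=-1$, $|\alpha_1'|^2-|\alpha_2'|^2=1$, $\alpha_1'\bar\alpha_1-\alpha_2'\bar\alpha_2=0$. The metric induced by $\phi$ from the Euclidean metric is $(|\gamma_1|^2+|\alpha_1|^2)(dt^2+ds^2)$, so $\phi$ is an immersion exactly when $|\gamma_1(s)|^2+|\alpha_1(t)|^2\neq0$ everywhere. The mean curvature vector is $H=\frac12\mathrm{trace}\,\sigma$ ($\sigma$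 the second fundamental form); it is parallel if it is parallel with respect to the normal connection (for a Lagrangian surface, equivalently, the tangent field $JH$ is parallel for the Levi-Civita connection of the induced metric). *)

(* Defs.v *)
From Stdlib Require Import Reals.
From Coquelicot Require Import Coquelicot.

Open Scope R_scope.

(** [Rbar_interval a b] with [Rbar_lt a b] ranges over all nonempty open
    intervals of [R], bounded or not.  Curves and surfaces are total functions
    of which only the values on such intervals (resp. products of two of them)
    matter; since these are open, derivatives there are intrinsic. *)
Definition Rbar_interval (a b : Rbar) (x : R) : Prop :=
  Rbar_lt a x /\ Rbar_lt x b.

Definition C2 : NormedModule R_AbsRing :=
  prod_NormedModule R_AbsRing C_R_NormedModule C_R_NormedModule.

Definition C2_inner (v w : C2) : R :=
  Re (fst v * Cconj (fst w) + snd v * Cconj (snd w))%C.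

(** Coquelicot's total [Derive] is only for real-valued functions; it is
    extended to curves in [C] and [C2] by components. *)
Definition C_derive_real (f : R -> C) (x : R) : C :=
  (Derive (fun y => Re (f y)) x, Derive (fun y => Im (f y)) x).

Definition C2_derive (f : R -> C2) (x : R) : C2 :=
  (C_derive_real (fun y => fst (f y)) x, C_derive_real (fun y => snd (f y)) x).

Lemma C2_derive_unique (f : R -> C2) (x : R) (l : C2) :
  is_derive f x l -> C2_derive f x = l.
Proof.
intros Hf.
assert (H1 : is_derive (V := C_R_NormedModule) (fun y => fst (f y)) x (fst l)).
{ apply (filterdiff_comp (U := R_NormedModule) (V := C2) f fst
           (fun y => scal y l) fst Hf).
  apply filterdiff_linear, is_linear_fst. }
assert (H2 : is_derive (V := C_R_NormedModule) (fun y => snd (f y)) x (snd l)).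
{ apply (filterdiff_comp (U := R_NormedModule) (V := C2) f snd
           (fun y => scal y l) snd Hf).
  apply filterdiff_linear, is_linear_snd. }
assert (HC : forall (g : R -> C) (m : C),
          is_derive (V := C_R_NormedModule) g x m -> C_derive_real g x = m).
{ intros g m Hg; unfold C_derive_real; rewrite (surjective_pairing m).
  f_equal; apply is_derive_unique.
  - apply (filterdiff_comp (U := R_NormedModule) (V := C_R_NormedModule)
             (W := R_NormedModule) g fst (fun y => scal y m) fst Hg).
    apply filterdiff_linear, (is_linear_fst (U := R_NormedModule) (V := R_NormedModule)).
  - apply (filterdiff_comp (U := R_NormedModule) (V := C_R_NormedModule)
             (W := R_NormedModule) g snd (fun y => scal y m) snd Hg).
    apply filterdiff_linear, (is_linear_snd (U := R_NormedModule) (V := R_NormedModule)). }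
rewrite (surjective_pairing l).
exact (f_equal2 pair (HC _ _ H1) (HC _ _ H2)).
Qed.

Definition smooth_on (I : R -> Prop) (f : R -> R) : Prop :=
  forall (n : nat) (x : R), I x -> ex_derive_n f n x.

Definition C2_smooth_on (I : R -> Prop) (c : R -> C2) : Prop :=
  smooth_on I (fun x => Re (fst (c x))) /\ smooth_on I (fun x => Im (fst (c x))) /\
  smooth_on I (fun x => Re (snd (c x))) /\ smooth_on I (fun x => Im (snd (c x))).

Definition S3 (p : C2) : Prop := Cmod (fst p) ^ 2 + Cmod (snd p) ^ 2 = 1.

Definition H31 (p : C2) : Prop := Cmod (fst p) ^ 2 - Cmod (snd p) ^ 2 = -1.

Definition unit_speed_legendre_S3 (I : R -> Prop) (c : R -> C2) : Prop :=
  C2_smooth_on I c /\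
  forall x, I x ->
    let c' := C2_derive c x in
    S3 (c x) /\
    Cmod (fst c') ^ 2 + Cmod (snd c') ^ 2 = 1 /\
    (fst c' * Cconj (fst (c x)) + snd c' * Cconj (snd (c x)) = 0)%C.

Definition unit_speed_legendre_H31 (I : R -> Prop) (c : R -> C2) : Prop :=
  C2_smooth_on I c /\
  forall x, I x ->
    let c' := C2_derive c x in
    H31 (c x) /\
    Cmod (fst c') ^ 2 - Cmod (snd c') ^ 2 = 1 /\
    (fst c' * Cconj (fst (c x)) - snd c' * Cconj (snd (c x)) = 0)%C.

Definition D_t (F : R -> R -> C2) (t s : R) : C2 := C2_derive (fun u => F u s) t.
Definition D_s (F : R -> R -> C2) (t s : R) : C2 := C2_derive (fun u => F t u) s.

(** Injectivity of the differential; smoothness is a separate matter (below,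
    [F] is a product of smooth curves). *)
Definition immersion (I J : R -> Prop) (F : R -> R -> C2) : Prop :=
  forall t s, I t -> J s -> forall a b : R,
    plus (scal a (D_t F t s)) (scal b (D_s F t s)) = zero -> a = 0 /\ b = 0.

Section Surface.

Variable F : R -> R -> C2.

(** Coefficients of the induced metric [g11 dt^2 + 2 g12 dt ds + g22 ds^2]. *)
Definition g11 (t s : R) : R := C2_inner (D_t F t s) (D_t F t s).
Definition g12 (t s : R) : R := C2_inner (D_t F t s) (D_s F t s).
Definition g22 (t s : R) : R := C2_inner (D_s F t s) (D_s F t s).
Definition gdet (t s : R) : R := g11 t s * g22 t s - g12 t s ^ 2.

(** Orthogonal projections: the tangential part of [v] is
    [sum_ij g^ij <v, D_i F> D_j F], where [(g^ij)] is the inverse of [(g_ij)]. *)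
Definition tangent_part (t s : R) (v : C2) : C2 :=
  let vt := C2_inner v (D_t F t s) in
  let vs := C2_inner v (D_s F t s) in
  plus (scal ((g22 t s * vt - g12 t s * vs) / gdet t s) (D_t F t s))
       (scal ((g11 t s * vs - g12 t s * vt) / gdet t s) (D_s F t s)).

Definition normal_part (t s : R) (v : C2) : C2 := minus v (tangent_part t s v).

(** Second fundamental form on coordinate fields: [sigma (d_i, d_j)] is the
    normal part of the flat derivative [D_i D_j F]. *)
Definition sigma_tt (t s : R) : C2 := normal_part t s (D_t (D_t F) t s).
Definition sigma_ts (t s : R) : C2 := normal_part t s (D_t (D_s F) t s).
Definition sigma_ss (t s : R) : C2 := normal_part t s (D_s (D_s F) t s).

(** [1/2 sum_ij g^ij sigma_ij] *)
Definition mean_curvature (t s : R) : C2 :=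
  scal (1 / (2 * gdet t s))
    (plus (minus (scal (g22 t s) (sigma_tt t s))
                 (scal (2 * g12 t s) (sigma_ts t s)))
          (scal (g11 t s) (sigma_ss t s))).

(** The normal connection on a normal field [N] is the normal part of the flat
    derivative of [N]. *)
Definition normal_parallel (I J : R -> Prop) (N : R -> R -> C2) : Prop :=
  forall t s, I t -> J s ->
    normal_part t s (D_t N t s) = zero /\ normal_part t s (D_s N t s) = zero.

End Surface.

Definition phi (alpha gamma : R -> C2) (t s : R) : C2 :=
  ((fst (alpha t) * fst (gamma s))%C, (snd (alpha t) * snd (gamma s))%C).

Definition constant_on (I : R -> Prop) (f : R -> R) : Prop :=
  exists c : R, forall x, I x -> f x = c.

(* Main.v *)
Require Import Defs.
From Stdlib Require Import Reals Lra.
From Coquelicot Require Import Coquelicot.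
Open Scope R_scope.

(** Both curves satisfy the same Frenet equation: if [e = 1] for [gamma] and
    [e = -1] for [alpha], the pair [c, c'] is orthogonal for the Hermitian form
    [herm e], so that [c'' = - e c + i k c'] with [k] the (real) curvature.
    Hence, with [p] and [q] the curvatures of [alpha] and [gamma], the terms
    [- e c] cancel in [phi_tt + phi_ss = i (p phi_t + q phi_s)].  The
    vectors [phi_t], [phi_s] are Hermitian orthogonal of the same square norm
    [W = |alpha_1|^2 + |gamma_1|^2], so [i phi_t] and [i phi_s] are normal and
    [H = i (p phi_t + q phi_s) / (2 W)] ([phi_mean_curvature]).

    A vector is tangent exactly when its Hermitian products with [phi_t] and
    [phi_s] are real.  Applied to [H_t] and [H_s], this turns parallelism into
    three scalar equations ([phi_parallel_iff]): with
    [a = Re (alpha_1' conj alpha_1) = (|alpha_1|^2)' / 2] and [g] likewise for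
    [gamma], they are [q a + p g = 0], [W p' = p a - q g] and
    [W q' = q g - p a].

    If [|alpha_1|] and [|gamma_1|] are constant, then [a = g = 0].  Since also
    [k Im (c_1' conj c_1) = 1 - 2 e |c_1|^2] in that case, with a nonzero
    second factor on the left, the curvatures are constant, and for [e = -1]
    the right side is positive, so [p] does not vanish and neither does [H].

    Conversely [p'(t) = - q'(s)] for all [t] and [s], so both are a constant
    [c] up to sign, and the equations give
    [g (p^2 + q^2) = - c W q] and [a (p^2 + q^2) = c W p]; here
    [p^2 + q^2 <> 0] because [H <> 0].  If [c = 0] then [a = g = 0] and the
    moduli are constant.  If [c <> 0], then along a line [t = t0] the quotient
    [M = W / (p^2 + q^2)] is constant, hence [g = - c M q] where
    [q' = - c]; differentiating the Frenet equations of [gamma] repeatedly then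
    gives [1 + q^2 = 0] ([curvature_not_affine]). *)

(** * Calculus of curves in [C] and [C2] *)

Definition is_C_derive (f : R -> C) (x : R) (l : C) : Prop :=
  is_derive (fun y => Re (f y)) x (Re l) /\ is_derive (fun y => Im (f y)) x (Im l).

Definition is_C2_derive (c : R -> C2) (x : R) (l : C2) : Prop :=
  is_C_derive (fun y => fst (c y)) x (fst l) /\
  is_C_derive (fun y => snd (c y)) x (snd l).

Lemma C2_derive_correct (c : R -> C2) (x : R) (l : C2) :
  is_C2_derive c x l -> C2_derive c x = l.
Proof.
intros [[H1 H2] [H3 H4]]; unfold C2_derive, C_derive_real.
apply is_derive_unique in H1, H2, H3, H4.
destruct l as [[l1 l2] [l3 l4]]; cbn in *.
rewrite <- H1, <- H2, <- H3, <- H4; reflexivity.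
Qed.

Lemma is_C_derive_ext_loc (f g : R -> C) (x : R) (l : C) :
  locally x (fun y => f y = g y) -> is_C_derive f x l -> is_C_derive g x l.
Proof.
intros E [H1 H2]; split; (eapply is_derive_ext_loc; [| eassumption]);
  apply (filter_imp _ _ (fun y (Hy : f y = g y) => f_equal _ Hy) E).
Qed.

Lemma is_C2_derive_ext_loc (f g : R -> C2) (x : R) (l : C2) :
  locally x (fun y => f y = g y) -> is_C2_derive f x l -> is_C2_derive g x l.
Proof.
intros E [H1 H2]; split; (eapply is_C_derive_ext_loc; [| eassumption]);
  apply (filter_imp _ _ (fun y (Hy : f y = g y) => f_equal _ Hy) E).
Qed.

Lemma is_C_derive_unique (f : R -> C) (x : R) (l m : C) :
  is_C_derive f x l -> is_C_derive f x m -> l = m.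
Proof.
intros [H1 H2] [H3 H4].
apply is_derive_unique in H1, H2, H3, H4.
destruct l, m; cbn in *; congruence.
Qed.

Lemma is_C_derive_const (z : C) (x : R) : is_C_derive (fun _ => z) x 0%C.
Proof. split; apply (@is_derive_const R_AbsRing R_NormedModule). Qed.

Lemma is_C_derive_plus (f g : R -> C) (x : R) (l m : C) :
  is_C_derive f x l -> is_C_derive g x m ->
  is_C_derive (fun y => f y + g y)%C x (l + m)%C.
Proof.
intros [H1 H2] [H3 H4]; split; cbn;
  apply (@is_derive_plus R_AbsRing R_NormedModule); assumption.
Qed.

Lemma is_derive_Rmult (f g : R -> R) (x l m : R) :
  is_derive f x l -> is_derive g x m ->
  is_derive (fun y => f y * g y) x (l * g x + f x * m).
Proof. intros Hf Hg; exact (is_derive_mult f g x l m Hf Hg Rmult_comm). Qed.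

(** The shape of the coefficients [p / (2 W)] and [q / (2 W)] of the mean curvature vector. *)
Lemma is_derive_half_quot (f w : R -> R) (x df dw : R) :
  is_derive f x df -> is_derive w x dw -> w x <> 0 ->
  is_derive (fun y => f y / (2 * w y)) x ((df * w x - f x * dw) / (2 * w x ^ 2)).
Proof.
intros Hf Hw H0.
replace ((df * w x - f x * dw) / (2 * w x ^ 2))
  with ((df * (2 * w x) - f x * (2 * dw)) / (2 * w x) ^ 2) by (field; exact H0).
assert (H2 : 2 * w x <> 0) by lra.
exact (is_derive_div f (fun y => 2 * w y) x _ _ Hf (is_derive_scal w x 2 dw Hw) H2).
Qed.

Lemma is_derive_plus_const (f : R -> R) (x df k : R) :
  is_derive f x df ->
  is_derive (fun y => f y + k) x df /\ is_derive (fun y => k + f y) x df.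
Proof.
intros Hf.
assert (H : is_derive (fun y => f y + k) x (df + 0))
  by exact (@is_derive_plus R_AbsRing R_NormedModule _ _ _ _ _ Hf (is_derive_const k x)).
rewrite Rplus_0_r in H; split; [exact H |].
apply is_derive_ext with (2 := H); intros y; apply Rplus_comm.
Qed.

Lemma derive_eq_on_open (I : R -> Prop) (f g : R -> R) (x l m : R) :
  open I -> I x -> (forall y, I y -> f y = g y) ->
  is_derive f x l -> is_derive g x m -> l = m.
Proof.
intros HI Hx E Hf Hg.
assert (Hf' : is_derive g x l).
{ apply is_derive_ext_loc with (2 := Hf).
  exact (filter_imp I _ E (HI x Hx)). }
apply is_derive_unique in Hf', Hg; congruence.
Qed.

Lemma is_C_derive_mult (f g : R -> C) (x : R) (l m : C) :
  is_C_derive f x l -> is_C_derive g x m ->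
  is_C_derive (fun y => f y * g y)%C x (l * g x + f x * m)%C.
Proof.
intros [H1 H2] [H3 H4]; split.
- replace (Re (l * g x + f x * m)%C)
    with (minus (Re l * Re (g x) + Re (f x) * Re m) (Im l * Im (g x) + Im (f x) * Im m))
    by (unfold minus, plus, opp, Re, Im; cbn; ring).
  exact (@is_derive_minus R_AbsRing R_NormedModule _ _ _ _ _
           (is_derive_Rmult _ _ _ _ _ H1 H3) (is_derive_Rmult _ _ _ _ _ H2 H4)).
- replace (Im (l * g x + f x * m)%C)
    with (plus (Re l * Im (g x) + Re (f x) * Im m) (Im l * Re (g x) + Im (f x) * Re m))
    by (unfold plus, Re, Im; cbn; ring).
  exact (@is_derive_plus R_AbsRing R_NormedModule _ _ _ _ _
           (is_derive_Rmult _ _ _ _ _ H1 H4) (is_derive_Rmult _ _ _ _ _ H2 H3)).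
Qed.

Lemma is_C_derive_conj (f : R -> C) (x : R) (l : C) :
  is_C_derive f x l -> is_C_derive (fun y => Cconj (f y)) x (Cconj l).
Proof.
intros [H1 H2]; split; cbn; [assumption |].
apply (@is_derive_opp R_AbsRing R_NormedModule); assumption.
Qed.

Lemma is_C_derive_const_mult (z : C) (f : R -> C) (x : R) (l : C) :
  is_C_derive f x l -> is_C_derive (fun y => z * f y)%C x (z * l)%C.
Proof.
intros H; replace (z * l)%C with (0 * f x + z * l)%C by ring.
apply is_C_derive_mult; [apply is_C_derive_const | exact H].
Qed.

Lemma C2_smooth_is_derive (I : R -> Prop) (c : R -> C2) (x : R) :
  C2_smooth_on I c -> I x -> is_C2_derive c x (C2_derive c x).
Proof.
intros (H1 & H2 & H3 & H4) Hx; split; split; apply Derive_correct.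
- exact (H1 1%nat x Hx).
- exact (H2 1%nat x Hx).
- exact (H3 1%nat x Hx).
- exact (H4 1%nat x Hx).
Qed.

Lemma smooth_on_Derive (I : R -> Prop) (f : R -> R) :
  smooth_on I f -> smooth_on I (Derive f).
Proof.
intros H [| n] x Hx; [exact Logic.I |].
apply ex_derive_ext with (f := Derive_n f (S n)); [| exact (H (S (S n)) x Hx)].
intros t; rewrite <- (PeanoNat.Nat.add_1_r n).
symmetry; exact (Derive_n_comp f n 1 t).
Qed.

Lemma C2_smooth_derive (I : R -> Prop) (c : R -> C2) :
  C2_smooth_on I c -> C2_smooth_on I (C2_derive c).
Proof.
intros (H1 & H2 & H3 & H4).
split; [| split; [| split]]; apply smooth_on_Derive; assumption.
Qed.

(** * Hermitian forms on [C2] *)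

Definition cscal (z : C) (v : C2) : C2 := ((z * fst v)%C, (z * snd v)%C).

Definition cprod (u v : C2) : C2 := ((fst u * fst v)%C, (snd u * snd v)%C).

(** The value [e = 1] gives the Hermitian product whose real part is the
    Euclidean metric and whose unit sphere is [S3]; for [e = -1] the vectors
    with [herm e u u = e] form [H31]. *)
Definition herm (e : R) (u v : C2) : C :=
  (fst u * Cconj (fst v) + RtoC e * (snd u * Cconj (snd v)))%C.

Lemma is_C2_derive_plus (f g : R -> C2) (x : R) (l m : C2) :
  is_C2_derive f x l -> is_C2_derive g x m ->
  is_C2_derive (fun y => plus (f y) (g y)) x (plus l m).
Proof.
intros [H1 H2] [H3 H4]; split; apply is_C_derive_plus; assumption.
Qed.

Lemma is_C2_derive_cscal (r : R -> R) (f : R -> C2) (x dr : R) (l : C2) :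
  is_derive r x dr -> is_C2_derive f x l ->
  is_C2_derive (fun y => cscal (0, r y) (f y)) x
    (plus (cscal (0, dr) (f x)) (cscal (0, r x) l)).
Proof.
intros Hr [H1 H2].
assert (H : is_C_derive (fun y => (0, r y)) x (0, dr)).
{ split; [exact (@is_derive_const R_AbsRing R_NormedModule 0 x) | exact Hr]. }
split; [exact (is_C_derive_mult _ _ _ _ _ H H1) | exact (is_C_derive_mult _ _ _ _ _ H H2)].
Qed.

Lemma is_C2_derive_cprod_r (f : R -> C2) (v : C2) (x : R) (l : C2) :
  is_C2_derive f x l -> is_C2_derive (fun y => cprod v (f y)) x (cprod v l).
Proof.
intros [H1 H2]; split;
  [exact (is_C_derive_const_mult _ _ _ _ H1) | exact (is_C_derive_const_mult _ _ _ _ H2)].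
Qed.

Lemma cprod_comm (u v : C2) : cprod u v = cprod v u.
Proof. unfold cprod; f_equal; apply Cmult_comm. Qed.

Lemma is_C2_derive_cprod_l (f : R -> C2) (v : C2) (x : R) (l : C2) :
  is_C2_derive f x l -> is_C2_derive (fun y => cprod (f y) v) x (cprod l v).
Proof.
intros H; rewrite (cprod_comm l v).
apply is_C2_derive_ext_loc with (f := fun y => cprod v (f y)).
- apply filter_forall; intros y; apply cprod_comm.
- apply is_C2_derive_cprod_r; exact H.
Qed.

Lemma is_C_derive_herm (e : R) (u v : R -> C2) (x : R) (u' v' : C2) :
  is_C2_derive u x u' -> is_C2_derive v x v' ->
  is_C_derive (fun y => herm e (u y) (v y)) x (herm e u' (v x) + herm e (u x) v')%C.
Proof.
intros [H1 H2] [H3 H4]; unfold herm.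
match goal with |- is_C_derive _ _ ?l =>
  replace l with
   ((fst u' * Cconj (fst (v x)) + fst (u x) * Cconj (fst v')) +
    RtoC e * (snd u' * Cconj (snd (v x)) + snd (u x) * Cconj (snd v')))%C by ring end.
exact (is_C_derive_plus _ _ _ _ _
  (is_C_derive_mult _ _ _ _ _ H1 (is_C_derive_conj _ _ _ H3))
  (is_C_derive_const_mult (RtoC e) _ _ _
     (is_C_derive_mult _ _ _ _ _ H2 (is_C_derive_conj _ _ _ H4)))).
Qed.

Lemma herm_sym (e : R) (u v : C2) : herm e v u = Cconj (herm e u v).
Proof.
destruct u as [[? ?] [? ?]], v as [[? ?] [? ?]]; unfold herm, RtoC, Cmult, Cplus, Cconj; cbn.
f_equal; ring.
Qed.

Lemma herm_plus_l (e : R) (u v w : C2) :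
  herm e (plus u v) w = (herm e u w + herm e v w)%C.
Proof.
change (((fst u + fst v) * Cconj (fst w) + RtoC e * ((snd u + snd v) * Cconj (snd w)))%C
  = (herm e u w + herm e v w)%C).
unfold herm; ring.
Qed.

Lemma herm_cscal_l (e : R) (z : C) (u w : C2) :
  herm e (cscal z u) w = (z * herm e u w)%C.
Proof.
change (((z * fst u) * Cconj (fst w) + RtoC e * ((z * snd u) * Cconj (snd w)))%C
  = (z * herm e u w)%C).
unfold herm; ring.
Qed.

(** Lagrange's identity. *)
Lemma herm_gram (e : R) (u v : C2) :
  (herm e u u * herm e v v - herm e u v * herm e v u =
   RtoC e * ((fst u * snd v - snd u * fst v) * Cconj (fst u * snd v - snd u * fst v)))%C.
Proof. unfold herm; rewrite Cminus_conj, !Cmult_conj; ring. Qed.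

Lemma C2_ext (u v : C2) : fst u = fst v -> snd u = snd v -> u = v.
Proof. destruct u, v; cbn; intros -> ->; reflexivity. Qed.

(** The Gram determinant of [u] and [v] is [e] times the square modulus of the
    determinant of [(u, v)], so when it is nonzero [u] and [v] span [C2] over
    [C]; it remains to solve a linear system. *)
Lemma herm_nondegenerate (e : R) (u v w : C2) :
  e <> 0 -> (herm e u u * herm e v v - herm e u v * herm e v u)%C <> 0%C ->
  herm e w u = 0%C -> herm e w v = 0%C -> w = zero.
Proof.
intros He HG Hu Hv.
rewrite herm_gram in HG; unfold herm in Hu, Hv.
set (d := (fst u * snd v - snd u * fst v)%C) in HG.
assert (Hd : Cconj d <> 0%C).
{ intros E; apply HG; rewrite E; ring. }
assert (He' : RtoC e <> 0%C) by (intros E; apply He; exact (RtoC_inj _ _ E)).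
unfold d in Hd; rewrite Cminus_conj, !Cmult_conj in Hd.
assert (H1 : ((Cconj (fst u) * Cconj (snd v) - Cconj (snd u) * Cconj (fst v)) * fst w)%C = 0%C).
{ transitivity (Cconj (snd v) * (fst w * Cconj (fst u) + e * (snd w * Cconj (snd u)))
   - Cconj (snd u) * (fst w * Cconj (fst v) + e * (snd w * Cconj (snd v))))%C;
  [ring | rewrite Hu, Hv; ring]. }
assert (H2 : (RtoC e * (Cconj (fst u) * Cconj (snd v) - Cconj (snd u) * Cconj (fst v)) * snd w)%C = 0%C).
{ transitivity (Cconj (fst u) * (fst w * Cconj (fst v) + e * (snd w * Cconj (snd v)))
   - Cconj (fst v) * (fst w * Cconj (fst u) + e * (snd w * Cconj (snd u))))%C;
  [ring | rewrite Hu, Hv; ring]. }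
assert (E1 : @eq C (fst w) (RtoC 0)).
{ destruct (Ceq_dec (fst w) (RtoC 0)) as [|n]; [assumption |].
  destruct (Cmult_neq_0 _ _ Hd n H1). }
assert (E2 : @eq C (snd w) (RtoC 0)).
{ destruct (Ceq_dec (snd w) (RtoC 0)) as [|n]; [assumption |].
  destruct (Cmult_neq_0 _ _ (Cmult_neq_0 _ _ He' Hd) n H2). }
exact (eq_trans (surjective_pairing w) (f_equal2 pair E1 E2)).
Qed.

(** Orthogonality of the first factors for the indefinite form says that
    [a_1 conj c_1 = a_2 conj c_2]; this common value then factors out of the
    definite product of the surface vectors.  With [herm_cprod_r], it reduces
    every metric quantity of [phi] to the two curves. *)
Lemma herm_cprod_l (a b c d : C2) : herm (-1) a c = 0%C ->
  herm 1 (cprod a b) (cprod c d) = (fst a * Cconj (fst c) * herm 1 b d)%C.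
Proof.
intros H.
assert (E : (snd a * Cconj (snd c) = fst a * Cconj (fst c) - herm (-1) a c)%C)
  by (unfold herm; ring).
change (herm 1 (cprod a b) (cprod c d)) with
  ((fst a * fst b) * Cconj (fst c * fst d)
   + RtoC 1 * ((snd a * snd b) * Cconj (snd c * snd d)))%C.
rewrite !Cmult_conj.
transitivity (fst a * Cconj (fst c) * (fst b * Cconj (fst d))
   + snd a * Cconj (snd c) * (snd b * Cconj (snd d)))%C; [ring |].
rewrite E, H; unfold herm; ring.
Qed.

(** The mirror statement: here [b_1 conj d_1 = - b_2 conj d_2], and the sign
    turns the definite form into the indefinite one. *)
Lemma herm_cprod_r (a b c d : C2) : herm 1 b d = 0%C ->
  herm 1 (cprod a b) (cprod c d) = (fst b * Cconj (fst d) * herm (-1) a c)%C.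
Proof.
intros H.
assert (E : (snd b * Cconj (snd d) = herm 1 b d - fst b * Cconj (fst d))%C)
  by (unfold herm; ring).
change (herm 1 (cprod a b) (cprod c d)) with
  ((fst a * fst b) * Cconj (fst c * fst d)
   + RtoC 1 * ((snd a * snd b) * Cconj (snd c * snd d)))%C.
rewrite !Cmult_conj.
transitivity (fst b * Cconj (fst d) * (fst a * Cconj (fst c))
   + snd b * Cconj (snd d) * (snd a * Cconj (snd c)))%C; [ring |].
rewrite E, H; unfold herm; ring.
Qed.

(** * Legendre curves *)

(** Unit speed Legendre curves of [S3] are the case [e = 1], those of [H31] the
    case [e = -1]. *)
Definition legendre (e : R) (I : R -> Prop) (c : R -> C2) : Prop :=
  C2_smooth_on I c /\
  forall x, I x ->
    herm e (c x) (c x) = RtoC e /\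
    herm e (C2_derive c x) (C2_derive c x) = RtoC 1 /\
    herm e (C2_derive c x) (c x) = RtoC 0.

Definition curvature (e : R) (c : R -> C2) (x : R) : R :=
  Im (herm e (C2_derive (C2_derive c) x) (C2_derive c x)).

Definition sqnorm1 (c : R -> C2) (x : R) : R := Cmod (fst (c x)) ^ 2.

(** Its real part is half the derivative of [|c_1|^2], its imaginary part is
    the angular momentum of the plane curve [c_1]. *)
Definition moment (c : R -> C2) (x : R) : C :=
  (fst (C2_derive c x) * Cconj (fst (c x)))%C.

Lemma herm_diag (e : R) (u : C2) :
  herm e u u = RtoC (Cmod (fst u) ^ 2 + e * Cmod (snd u) ^ 2).
Proof. rewrite RtoC_plus, RtoC_mult, !Cmod2_conj; reflexivity. Qed.

Lemma S3_legendre (I : R -> Prop) (c : R -> C2) :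
  unit_speed_legendre_S3 I c -> legendre 1 I c.
Proof.
intros [Hs H]; split; [exact Hs |]; intros x Hx.
destruct (H x Hx) as (H1 & H2 & H3); unfold S3 in H1; split; [| split].
- rewrite herm_diag, Rmult_1_l, H1; reflexivity.
- rewrite herm_diag, Rmult_1_l, H2; reflexivity.
- rewrite <- H3; unfold herm; ring.
Qed.

Lemma H31_legendre (I : R -> Prop) (c : R -> C2) :
  unit_speed_legendre_H31 I c -> legendre (-1) I c.
Proof.
intros [Hs H]; split; [exact Hs |]; intros x Hx.
destruct (H x Hx) as (H1 & H2 & H3); unfold H31 in H1; split; [| split].
- rewrite herm_diag; apply f_equal; lra.
- rewrite herm_diag; apply f_equal; lra.
- rewrite <- H3; unfold herm; ring.
Qed.

(** Differentiating [herm e c' c = 0] and [herm e c' c' = 1]. *)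
Lemma legendre_second_derivative (e : R) (I : R -> Prop) (c : R -> C2) (x : R) :
  open I -> legendre e I c -> I x ->
  herm e (C2_derive (C2_derive c) x) (c x) = RtoC (-1) /\
  herm e (C2_derive (C2_derive c) x) (C2_derive c x) = (0, curvature e c x).
Proof.
intros HI [Hs H] Hx.
pose proof (C2_smooth_is_derive I c x Hs Hx) as D1.
pose proof (C2_smooth_is_derive I _ x (C2_smooth_derive I c Hs) Hx) as D2.
destruct (H x Hx) as (_ & E2 & _).
split.
- assert (E := is_C_derive_herm e _ _ _ _ _ D2 D1).
  apply is_C_derive_ext_loc with (g := fun _ => RtoC 0) in E.
  2: { apply (filter_imp I); [| exact (HI x Hx)]; intros y Hy; apply (H y Hy). }
  assert (E' := is_C_derive_unique _ _ _ _ E (is_C_derive_const _ _)).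
  rewrite E2 in E'.
  transitivity (herm e (C2_derive (C2_derive c) x) (c x) + 1 + -1)%C; [ring |].
  rewrite E'; ring.
- assert (E := is_C_derive_herm e _ _ _ _ _ D2 D2).
  apply is_C_derive_ext_loc with (g := fun _ => RtoC 1) in E.
  2: { apply (filter_imp I); [| exact (HI x Hx)]; intros y Hy; apply (H y Hy). }
  assert (E' := is_C_derive_unique _ _ _ _ E (is_C_derive_const _ _)).
  rewrite (herm_sym e (C2_derive (C2_derive c) x)) in E'.
  unfold curvature; destruct (herm e (C2_derive (C2_derive c) x) (C2_derive c x)) as [a b].
  injection E' as E1 _; cbn in *; f_equal; lra.
Qed.

(** The Frenet equation: both sides have the same products with the basis
    [c, c'] of [C2]. *)
Lemma legendre_frame (e : R) (I : R -> Prop) (c : R -> C2) (x : R) :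
  e * e = 1 -> open I -> legendre e I c -> I x ->
  C2_derive (C2_derive c) x =
  plus (cscal (RtoC (- e)) (c x)) (cscal (0, curvature e c x) (C2_derive c x)).
Proof.
intros He HI HL Hx.
destruct (legendre_second_derivative e I c x HI HL Hx) as [E1 E2].
destruct (proj2 HL x Hx) as (F1 & F2 & F3).
set (k := curvature e c x) in *.
set (c2 := C2_derive (C2_derive c) x) in *; set (c1 := C2_derive c x) in *.
assert (F4 : herm e (c x) c1 = RtoC 0) by (rewrite herm_sym, F3; exact (f_equal (pair 0) Ropp_0)).
assert (HeC : (RtoC e * RtoC e = 1)%C) by (rewrite <- RtoC_mult, He; reflexivity).
assert (Z : plus c2 (plus (cscal (RtoC e) (c x)) (cscal (- (0, k)) c1)) = zero).
{ apply (herm_nondegenerate e (c x) c1).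
  - intros E; rewrite E in He; lra.
  - rewrite F1, F2, F3; intros E.
    assert (E' : RtoC e = RtoC 0) by (rewrite <- E; ring).
    apply RtoC_inj in E'; rewrite E' in He; lra.
  - rewrite !herm_plus_l, !herm_cscal_l, E1, F1, F3, HeC; ring.
  - rewrite !herm_plus_l, !herm_cscal_l, E2, F2, F4; ring. }
assert (solve : forall w u v : C, (w + (RtoC e * u + - (0, k) * v))%C = RtoC 0 ->
  w = (RtoC (- e) * u + (0, k) * v)%C).
{ intros w u v E; rewrite RtoC_opp.
  transitivity ((w + (RtoC e * u + - (0, k) * v)) + (- RtoC e * u + (0, k) * v))%C;
    [ring | rewrite E; ring]. }
apply C2_ext; [exact (solve _ _ _ (f_equal fst Z)) | exact (solve _ _ _ (f_equal snd Z))].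
Qed.

(** The second vector of an orthonormal pair of [C2] is, up to a phase,
    determined by the first, so all four moduli are functions of [|c_1|]. *)
Lemma legendre_coordinate_norms (e : R) (I : R -> Prop) (c : R -> C2) (x : R) :
  e * e = 1 -> legendre e I c -> I x ->
  Cmod (fst (C2_derive c x)) ^ 2 = 1 - e * sqnorm1 c x /\
  Cmod (snd (C2_derive c x)) ^ 2 = sqnorm1 c x /\
  Cmod (snd (c x)) ^ 2 = 1 - e * sqnorm1 c x.
Proof.
intros He HL Hx; unfold sqnorm1.
destruct (proj2 HL x Hx) as (F1 & F2 & F3).
set (c1 := C2_derive c x) in *; set (c0 := c x) in *.
assert (G1 : Cmod (fst c0) ^ 2 + e * Cmod (snd c0) ^ 2 = e).
{ apply RtoC_inj; rewrite <- herm_diag; exact F1. }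
assert (G2 : Cmod (fst c1) ^ 2 + e * Cmod (snd c1) ^ 2 = 1).
{ apply RtoC_inj; rewrite <- herm_diag; exact F2. }
assert (G3 : Cmod (fst c1) ^ 2 * Cmod (fst c0) ^ 2 = Cmod (snd c1) ^ 2 * Cmod (snd c0) ^ 2).
{ assert (G : (fst c1 * Cconj (fst c0) = - (RtoC e * (snd c1 * Cconj (snd c0))))%C).
  { transitivity (herm e c1 c0 - RtoC e * (snd c1 * Cconj (snd c0)))%C;
      [unfold herm; ring | rewrite F3; ring]. }
  apply (f_equal (fun z => Cmod z ^ 2)) in G.
  rewrite Cmod_opp, !Cmod_mult, !Cmod_conj, Cmod_R in G.
  rewrite !Rpow_mult_distr, pow2_abs in G.
  rewrite G; simpl; nra. }
set (r1 := Cmod (fst c1) ^ 2) in *; set (r2 := Cmod (snd c1) ^ 2) in *.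
set (s1 := Cmod (fst c0) ^ 2) in *; set (s2 := Cmod (snd c0) ^ 2) in *.
clearbody r1 r2 s1 s2; clear - He G1 G2 G3.
assert (A : s2 = 1 - e * s1) by (transitivity (e * e * s2); [rewrite He |]; nra).
assert (B : r2 = e - e * r1) by (transitivity (e * e * r2); [rewrite He |]; nra).
subst s2 r2.
assert (K : e * r1 = e - s1).
{ assert (K : (e - e * r1) * (1 - e * s1) = e - e * r1 - e * e * s1 + e * e * (r1 * s1)) by ring.
  rewrite He in K; lra. }
assert (K' : r1 = 1 - e * s1).
{ transitivity (e * e * r1); [rewrite He; ring |].
  rewrite Rmult_assoc, K, <- He; ring. }
split; [| split]; lra.
Qed.

Lemma sqnorm1_derive (e : R) (I : R -> Prop) (c : R -> C2) (x : R) :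
  legendre e I c -> I x -> is_derive (sqnorm1 c) x (2 * Re (moment c x)).
Proof.
intros [Hs _] Hx.
destruct (C2_smooth_is_derive I c x Hs Hx) as [D1 _].
destruct (is_C_derive_mult _ _ _ _ _ D1 (is_C_derive_conj _ _ _ D1)) as [D _].
replace (2 * Re (moment c x)) with
  (Re (fst (C2_derive c x) * Cconj (fst (c x)) + fst (c x) * Cconj (fst (C2_derive c x)))%C).
- eapply is_derive_ext; [| exact D].
  intros t; exact (f_equal Re (eq_sym (Cmod2_conj (fst (c t))))).
- unfold moment; set (u := fst (C2_derive c x)); set (v := fst (c x)).
  destruct u, v; unfold Re; cbn; ring.
Qed.

(** The first coordinate of the Frenet equation, multiplied by [conj c_1]. *)
Lemma moment_derive (e : R) (I : R -> Prop) (c : R -> C2) (x : R) :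
  e * e = 1 -> open I -> legendre e I c -> I x ->
  is_derive (fun y => Re (moment c y)) x
    (1 - 2 * e * sqnorm1 c x - curvature e c x * Im (moment c x)) /\
  is_derive (fun y => Im (moment c y)) x (curvature e c x * Re (moment c x)).
Proof.
intros He HI HL Hx.
assert (Hs := proj1 HL).
destruct (C2_smooth_is_derive I c x Hs Hx) as [D1 _].
destruct (C2_smooth_is_derive I _ x (C2_smooth_derive I c Hs) Hx) as [D2 _].
assert (D := is_C_derive_mult _ _ _ _ _ D2 (is_C_derive_conj _ _ _ D1)).
assert (F := f_equal fst (legendre_frame e I c x He HI HL Hx)
  : fst (C2_derive (C2_derive c) x) =
    (RtoC (- e) * fst (c x) + (0, curvature e c x) * fst (C2_derive c x))%C).
assert (S := proj1 (legendre_coordinate_norms e I c x He HL Hx)).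
assert (E : (fst (C2_derive (C2_derive c) x) * Cconj (fst (c x)) +
  fst (C2_derive c x) * Cconj (fst (C2_derive c x)))%C =
  (1 - 2 * e * sqnorm1 c x - curvature e c x * Im (moment c x),
   curvature e c x * Re (moment c x))).
{ rewrite F, <- (Cmod2_conj (fst (C2_derive c x))), S.
  transitivity (RtoC (- e) * (fst (c x) * Cconj (fst (c x))) + (0, curvature e c x) * moment c x
    + RtoC (1 - e * sqnorm1 c x))%C; [unfold moment; ring |].
  rewrite <- Cmod2_conj; fold (sqnorm1 c x).
  destruct (moment c x); unfold RtoC, Cmult, Cplus; cbn; f_equal; ring. }
exact (eq_ind _ (is_C_derive (moment c) x) D _ E).
Qed.

Lemma moment_sqnorm (e : R) (I : R -> Prop) (c : R -> C2) (x : R) :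
  e * e = 1 -> legendre e I c -> I x ->
  Re (moment c x) ^ 2 + Im (moment c x) ^ 2 = sqnorm1 c x * (1 - e * sqnorm1 c x).
Proof.
intros He HL Hx.
destruct (legendre_coordinate_norms e I c x He HL Hx) as [S _].
rewrite <- Cmod2_alt, <- S; unfold moment, sqnorm1.
rewrite Cmod_mult, Cmod_conj; ring.
Qed.

Lemma curvature_derive (e : R) (I : R -> Prop) (c : R -> C2) (x : R) :
  legendre e I c -> I x -> is_derive (curvature e c) x (Derive (curvature e c) x).
Proof.
intros [Hs _] Hx; apply Derive_correct.
assert (Hs1 := C2_smooth_derive I c Hs); assert (Hs2 := C2_smooth_derive I _ Hs1).
destruct (is_C_derive_herm e _ _ _ _ _
  (C2_smooth_is_derive I _ x Hs2 Hx) (C2_smooth_is_derive I _ x Hs1 Hx)) as [_ D].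
eexists; exact D.
Qed.

(** * Normal projection and mean curvature in a conformal Lagrangian frame *)

Lemma herm_scal_l (e a : R) (u w : C2) :
  herm e (scal a u) w = (RtoC a * herm e u w)%C.
Proof.
replace (scal a u) with (cscal (RtoC a) u); [apply herm_cscal_l |].
apply C2_ext; symmetry; apply scal_R_Cmult.
Qed.

Lemma herm_minus_l (e : R) (u v w : C2) :
  herm e (minus u v) w = (herm e u w - herm e v w)%C.
Proof.
change (((fst u - fst v) * Cconj (fst w) + RtoC e * ((snd u - snd v) * Cconj (snd w)))%C
  = (herm e u w - herm e v w)%C).
unfold herm; ring.
Qed.

Lemma herm_zero_l (e : R) (w : C2) : herm e zero w = RtoC 0.
Proof.
transitivity (RtoC 0 * Cconj (fst w) + RtoC e * (RtoC 0 * Cconj (snd w)))%C;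
  [reflexivity | ring].
Qed.

Lemma C2_inner_herm (u v : C2) : C2_inner u v = Re (herm 1 u v).
Proof. unfold C2_inner, herm; apply f_equal; ring. Qed.

(** Hermitian orthogonality says at once that the plane of [X] and [Y] is
    Lagrangian and that [X], [Y] are orthogonal for the metric. *)
Definition conformal_frame (W : R) (X Y : C2) : Prop :=
  W <> 0 /\ herm 1 X X = RtoC W /\ herm 1 Y Y = RtoC W /\
  herm 1 X Y = RtoC 0 /\ herm 1 Y X = RtoC 0.

(** [X] and [Y] form a basis of [C2] over [C]. *)
Lemma conformal_frame_ext (W : R) (X Y u v : C2) :
  conformal_frame W X Y ->
  herm 1 u X = herm 1 v X -> herm 1 u Y = herm 1 v Y -> u = v.
Proof.
intros (HW & HXX & HYY & HXY & HYX) EX EY.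
assert (Z : minus u v = zero).
{ apply (herm_nondegenerate 1 X Y).
  - lra.
  - rewrite HXX, HYY, HXY, HYX; intros E.
    assert (E' : RtoC (W * W) = RtoC 0) by (rewrite RtoC_mult, <- E; ring).
    apply RtoC_inj in E'; apply HW; nra.
  - rewrite herm_minus_l, EX; ring.
  - rewrite herm_minus_l, EY; ring. }
apply (plus_reg_r (opp v)); rewrite plus_opp_r; exact Z.
Qed.

(** For a Lagrangian plane, [v = (herm v X / W) X + (herm v Y / W) Y] splits
    into tangential and normal parts by taking the real and imaginary parts of
    the coefficients. *)
Lemma normal_part_frame (F : R -> R -> C2) (t s W : R) (v : C2) :
  conformal_frame W (D_t F t s) (D_s F t s) ->
  normal_part F t s v =
  plus (cscal (0, Im (herm 1 v (D_t F t s)) / W) (D_t F t s))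
       (cscal (0, Im (herm 1 v (D_s F t s)) / W) (D_s F t s)).
Proof.
intros HF; apply (conformal_frame_ext W _ _ _ _ HF);
  destruct HF as (HW & HXX & HYY & HXY & HYX);
  unfold normal_part, tangent_part, gdet, g11, g12, g22;
  rewrite !C2_inner_herm, herm_minus_l, !herm_plus_l, !herm_scal_l, !herm_cscal_l,
    ?HXX, ?HYY, ?HXY, ?HYX;
  destruct (herm 1 v (D_t F t s)) as [a b], (herm 1 v (D_s F t s)) as [c d];
  unfold RtoC, Re, Im, Cminus, Cmult, Cplus, Copp; cbn; f_equal; field; assumption.
Qed.

Lemma normal_part_eq_0 (F : R -> R -> C2) (t s W : R) (v : C2) :
  conformal_frame W (D_t F t s) (D_s F t s) ->
  (normal_part F t s v = zero <->
   Im (herm 1 v (D_t F t s)) = 0 /\ Im (herm 1 v (D_s F t s)) = 0).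
Proof.
intros HF; rewrite (normal_part_frame F t s W v HF).
pose proof HF as (HW & HXX & HYY & HXY & HYX).
split.
- set (a := Im (herm 1 v (D_t F t s))); set (b := Im (herm 1 v (D_s F t s))).
  clearbody a b; intros E.
  assert (EX := f_equal (fun u => herm 1 u (D_t F t s)) E).
  assert (EY := f_equal (fun u => herm 1 u (D_s F t s)) E).
  cbv beta in EX, EY.
  rewrite herm_zero_l, herm_plus_l, !herm_cscal_l, HXX, HYX in EX.
  rewrite herm_zero_l, herm_plus_l, !herm_cscal_l, HXY, HYY in EY.
  apply (f_equal Im) in EX, EY.
  unfold RtoC, Cmult, Cplus in EX, EY; cbn in EX, EY.
  split; [refine (eq_trans _ EX) | refine (eq_trans _ EY)]; field; assumption.
- intros [-> ->]; apply (conformal_frame_ext W _ _ _ _ HF);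
  rewrite herm_zero_l, herm_plus_l, !herm_cscal_l, ?HXX, ?HYY, ?HXY, ?HYX;
  unfold RtoC, Cmult, Cplus; cbn; f_equal; field; assumption.
Qed.

(** Only the sum of the two pure second derivatives matters, because the
    metric is conformal. *)
Lemma mean_curvature_frame (F : R -> R -> C2) (t s W p q : R) :
  conformal_frame W (D_t F t s) (D_s F t s) ->
  Im (herm 1 (D_t (D_t F) t s) (D_t F t s)) + Im (herm 1 (D_s (D_s F) t s) (D_t F t s)) = p * W ->
  Im (herm 1 (D_t (D_t F) t s) (D_s F t s)) + Im (herm 1 (D_s (D_s F) t s) (D_s F t s)) = q * W ->
  mean_curvature F t s =
  plus (cscal (0, p / (2 * W)) (D_t F t s)) (cscal (0, q / (2 * W)) (D_s F t s)).
Proof.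
intros HF Hp Hq.
unfold mean_curvature, sigma_tt, sigma_ts, sigma_ss.
rewrite !(normal_part_frame F t s W _ HF).
pose proof HF as (HW & HXX & HYY & HXY & HYX).
replace p with ((Im (herm 1 (D_t (D_t F) t s) (D_t F t s))
  + Im (herm 1 (D_s (D_s F) t s) (D_t F t s))) / W) by (rewrite Hp; field; exact HW).
replace q with ((Im (herm 1 (D_t (D_t F) t s) (D_s F t s))
  + Im (herm 1 (D_s (D_s F) t s) (D_s F t s))) / W) by (rewrite Hq; field; exact HW).
clear Hp Hq; apply (conformal_frame_ext W _ _ _ _ HF);
  unfold gdet, g11, g12, g22;
  rewrite !C2_inner_herm, herm_scal_l, !herm_plus_l, herm_minus_l, !herm_scal_l,
    !herm_plus_l, !herm_cscal_l, ?HXX, ?HYY, ?HXY, ?HYX;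
  unfold RtoC, Re, Cminus, Cmult, Cplus, Copp; cbn; f_equal; field; assumption.
Qed.


(** * The Lagrangian surface [phi] *)

Lemma D_t_of_local (G : R -> R -> C2) (f : R -> C2) (t s : R) (l : C2) :
  locally t (fun u => f u = G u s) -> is_C2_derive f t l -> D_t G t s = l.
Proof.
intros E D; apply C2_derive_correct; exact (is_C2_derive_ext_loc _ _ _ _ E D).
Qed.

Lemma D_s_of_local (G : R -> R -> C2) (f : R -> C2) (t s : R) (l : C2) :
  locally s (fun u => f u = G t u) -> is_C2_derive f s l -> D_s G t s = l.
Proof.
intros E D; apply C2_derive_correct; exact (is_C2_derive_ext_loc _ _ _ _ E D).
Qed.

Lemma phi_first_derivatives (I J : R -> Prop) (alpha gamma : R -> C2) (t s : R) :
  C2_smooth_on I alpha -> C2_smooth_on J gamma -> I t -> J s ->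
  D_t (phi alpha gamma) t s = cprod (C2_derive alpha t) (gamma s) /\
  D_s (phi alpha gamma) t s = cprod (alpha t) (C2_derive gamma s).
Proof.
intros Ha Hg Ht Hs; split; apply C2_derive_correct.
- exact (is_C2_derive_cprod_l _ (gamma s) _ _ (C2_smooth_is_derive I alpha t Ha Ht)).
- exact (is_C2_derive_cprod_r _ (alpha t) _ _ (C2_smooth_is_derive J gamma s Hg Hs)).
Qed.

Lemma phi_second_derivatives (I J : R -> Prop) (alpha gamma : R -> C2) (t s : R) :
  open I -> open J ->
  C2_smooth_on I alpha -> C2_smooth_on J gamma -> I t -> J s ->
  is_C2_derive (fun u => D_t (phi alpha gamma) u s) t
    (cprod (C2_derive (C2_derive alpha) t) (gamma s)) /\
  is_C2_derive (fun u => D_s (phi alpha gamma) u s) t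
    (cprod (C2_derive alpha t) (C2_derive gamma s)) /\
  is_C2_derive (fun u => D_t (phi alpha gamma) t u) s
    (cprod (C2_derive alpha t) (C2_derive gamma s)) /\
  is_C2_derive (fun u => D_s (phi alpha gamma) t u) s
    (cprod (alpha t) (C2_derive (C2_derive gamma) s)).
Proof.
intros HI HJ Ha Hg Ht Hs.
assert (Ha' := C2_smooth_derive I alpha Ha).
assert (Hg' := C2_smooth_derive J gamma Hg).
assert (First := fun u v Hu Hv => phi_first_derivatives I J alpha gamma u v Ha Hg Hu Hv).
split; [| split; [| split]].
- apply is_C2_derive_ext_loc with (f := fun u => cprod (C2_derive alpha u) (gamma s)).
  + apply (filter_imp I); [| exact (HI t Ht)].
    intros u Hu; symmetry; exact (proj1 (First u s Hu Hs)).
  + exact (is_C2_derive_cprod_l _ _ _ _ (C2_smooth_is_derive I _ t Ha' Ht)).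
- apply is_C2_derive_ext_loc with (f := fun u => cprod (alpha u) (C2_derive gamma s)).
  + apply (filter_imp I); [| exact (HI t Ht)].
    intros u Hu; symmetry; exact (proj2 (First u s Hu Hs)).
  + exact (is_C2_derive_cprod_l _ _ _ _ (C2_smooth_is_derive I _ t Ha Ht)).
- apply is_C2_derive_ext_loc with (f := fun u => cprod (C2_derive alpha t) (gamma u)).
  + apply (filter_imp J); [| exact (HJ s Hs)].
    intros u Hu; symmetry; exact (proj1 (First t u Ht Hu)).
  + exact (is_C2_derive_cprod_r _ _ _ _ (C2_smooth_is_derive J _ s Hg Hs)).
- apply is_C2_derive_ext_loc with (f := fun u => cprod (alpha t) (C2_derive gamma u)).
  + apply (filter_imp J); [| exact (HJ s Hs)].
    intros u Hu; symmetry; exact (proj2 (First t u Ht Hu)).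
  + exact (is_C2_derive_cprod_r _ _ _ _ (C2_smooth_is_derive J _ s Hg' Hs)).
Qed.

Lemma herm_diag_cprod (a b : C2) :
  herm 1 (cprod a b) (cprod a b) =
  RtoC (Cmod (fst a) ^ 2 * Cmod (fst b) ^ 2 + Cmod (snd a) ^ 2 * Cmod (snd b) ^ 2).
Proof.
rewrite herm_diag; apply f_equal; cbn [fst snd cprod]; rewrite !Cmod_mult; ring.
Qed.

Lemma cprod_plus_l (u v w : C2) : cprod (plus u v) w = plus (cprod u w) (cprod v w).
Proof. apply C2_ext; [exact (Cmult_plus_distr_r _ _ _) | exact (Cmult_plus_distr_r _ _ _)]. Qed.

Lemma cprod_cscal_l (z : C) (u w : C2) : cprod (cscal z u) w = cscal z (cprod u w).
Proof. apply C2_ext; symmetry; exact (Cmult_assoc _ _ _). Qed.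

Lemma phi_first_products (I J : R -> Prop) (alpha gamma : R -> C2) (t s : R) :
  legendre (-1) I alpha -> legendre 1 J gamma -> I t -> J s ->
  let X := cprod (C2_derive alpha t) (gamma s) in
  let Y := cprod (alpha t) (C2_derive gamma s) in
  let W := sqnorm1 alpha t + sqnorm1 gamma s in
  herm 1 X X = RtoC W /\ herm 1 Y Y = RtoC W /\
  herm 1 X Y = RtoC 0 /\ herm 1 Y X = RtoC 0.
Proof.
intros Ha Hg Ht Hs X Y W.
assert (m1 : (-1) * (-1) = 1) by ring.
destruct (legendre_coordinate_norms _ I alpha t m1 Ha Ht) as (A1 & A2 & A3).
destruct (legendre_coordinate_norms _ J gamma s (Rmult_1_l 1) Hg Hs) as (G1 & G2 & G3).
assert (XY : herm 1 X Y = RtoC 0).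
{ unfold X, Y; rewrite herm_cprod_l by apply (proj2 Ha t Ht).
  rewrite (herm_sym 1 (C2_derive gamma s)).
  destruct (proj2 Hg s Hs) as (_ & _ & ->).
  replace (Cconj (RtoC 0)) with (RtoC 0) by exact (f_equal (pair 0) (eq_sym Ropp_0)).
  ring. }
split; [| split; [| split]].
- unfold X; rewrite herm_diag_cprod, A1, A2, G3; fold (sqnorm1 gamma s).
  apply f_equal; unfold W; ring.
- unfold Y; rewrite herm_diag_cprod, A3, G1, G2; fold (sqnorm1 alpha t).
  apply f_equal; unfold W; ring.
- exact XY.
- rewrite herm_sym, XY; exact (f_equal (pair 0) Ropp_0).
Qed.

(** In each product one of the two pairs of factors is orthogonal, which allows
    [herm_cprod_l] or [herm_cprod_r]; for [XX, X] and [YY, Y] this becomes true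
    after the Frenet equation is used. *)
Lemma phi_second_products (I J : R -> Prop) (alpha gamma : R -> C2) (t s : R) :
  open I -> open J ->
  legendre (-1) I alpha -> legendre 1 J gamma -> I t -> J s ->
  let X := cprod (C2_derive alpha t) (gamma s) in
  let Y := cprod (alpha t) (C2_derive gamma s) in
  let W := sqnorm1 alpha t + sqnorm1 gamma s in
  let XX := cprod (C2_derive (C2_derive alpha) t) (gamma s) in
  let XY := cprod (C2_derive alpha t) (C2_derive gamma s) in
  let YY := cprod (alpha t) (C2_derive (C2_derive gamma) s) in
  herm 1 XX X = (Cconj (moment alpha t) + (0, curvature (-1) alpha t) * RtoC W)%C /\
  herm 1 XX Y = (- Cconj (moment gamma s))%C /\
  herm 1 XY X = moment gamma s /\
  herm 1 XY Y = moment alpha t /\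
  herm 1 YY X = (- Cconj (moment alpha t))%C /\
  herm 1 YY Y = (Cconj (moment gamma s) + (0, curvature 1 gamma s) * RtoC W)%C.
Proof.
intros HI HJ Ha Hg Ht Hs X Y W XX XY YY.
assert (m1 : (-1) * (-1) = 1) by ring.
destruct (phi_first_products I J alpha gamma t s Ha Hg Ht Hs) as (PX & PY & PXY & PYX).
fold X Y W in PX, PY, PXY, PYX.
destruct (proj2 Ha t Ht) as (Ha00 & Ha11 & Ha10).
destruct (proj2 Hg s Hs) as (Hg00 & Hg11 & Hg10).
destruct (legendre_second_derivative _ I alpha t HI Ha Ht) as [Ha20 _].
destruct (legendre_second_derivative _ J gamma s HJ Hg Hs) as [Hg20 _].
assert (C0 : Cconj (RtoC 0) = RtoC 0) by exact (f_equal (pair 0) Ropp_0).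
assert (Ha01 : herm (-1) (alpha t) (C2_derive alpha t) = RtoC 0)
  by (rewrite herm_sym, Ha10; exact C0).
assert (Hg01 : herm 1 (gamma s) (C2_derive gamma s) = RtoC 0)
  by (rewrite herm_sym, Hg10; exact C0).
assert (Ma : (fst (alpha t) * Cconj (fst (C2_derive alpha t)))%C = Cconj (moment alpha t))
  by (unfold moment; rewrite Cmult_conj, Cconj_conj; apply Cmult_comm).
assert (Mg : (fst (gamma s) * Cconj (fst (C2_derive gamma s)))%C = Cconj (moment gamma s))
  by (unfold moment; rewrite Cmult_conj, Cconj_conj; apply Cmult_comm).
repeat split.
- unfold XX; rewrite (legendre_frame _ I alpha t m1 HI Ha Ht).
  rewrite cprod_plus_l, !cprod_cscal_l, herm_plus_l, !herm_cscal_l; fold X; rewrite PX.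
  unfold X; rewrite (herm_cprod_l _ _ _ _ Ha01), Hg00, Ma.
  replace (- -1) with 1 by ring; ring.
- unfold XX, Y; rewrite (herm_cprod_r _ _ _ _ Hg01), Ha20, Mg; ring.
- unfold XY, X; rewrite (herm_cprod_r _ _ _ _ Hg10), Ha11.
  fold (moment gamma s); ring.
- unfold XY, Y; rewrite (herm_cprod_l _ _ _ _ Ha10), Hg11.
  fold (moment alpha t); ring.
- unfold YY, X; rewrite (herm_cprod_l _ _ _ _ Ha01), Hg20, Ma; ring.
- unfold YY; rewrite (legendre_frame _ J gamma s (Rmult_1_l 1) HJ Hg Hs).
  rewrite cprod_comm, cprod_plus_l, !cprod_cscal_l, !(cprod_comm _ (alpha t)); fold Y.
  rewrite herm_plus_l, !herm_cscal_l, PY.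
  unfold Y; rewrite (herm_cprod_r _ _ _ _ Hg01), Ha00, Mg, RtoC_opp; ring.
Qed.

(** If [W = 0] then [alpha_1 = gamma_1 = 0], and since [|alpha_2'| = |alpha_1|]
    the vector [phi_t] vanishes, against the immersion hypothesis. *)
Lemma phi_conformal_frame (I J : R -> Prop) (alpha gamma : R -> C2) (t s : R) :
  legendre (-1) I alpha -> legendre 1 J gamma -> immersion I J (phi alpha gamma) ->
  I t -> J s ->
  conformal_frame (sqnorm1 alpha t + sqnorm1 gamma s)
    (cprod (C2_derive alpha t) (gamma s)) (cprod (alpha t) (C2_derive gamma s)).
Proof.
intros Ha Hg Himm Ht Hs; split; [| exact (phi_first_products I J _ _ t s Ha Hg Ht Hs)].
assert (m1 : (-1) * (-1) = 1) by ring.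
destruct (legendre_coordinate_norms _ I alpha t m1 Ha Ht) as (A1 & A2 & A3).
destruct (phi_first_derivatives I J alpha gamma t s (proj1 Ha) (proj1 Hg) Ht Hs) as [Dt Ds].
intros W0.
assert (Hsa : 0 <= sqnorm1 alpha t) by apply pow2_ge_0.
assert (Hsg : 0 <= sqnorm1 gamma s) by apply pow2_ge_0.
assert (a0 : sqnorm1 alpha t = 0) by lra.
assert (g0 : sqnorm1 gamma s = 0) by lra.
assert (root : forall z : C, Cmod z ^ 2 = 0 -> z = RtoC 0).
{ intros z Hz; apply Cmod_eq_0; nra. }
assert (E : cprod (C2_derive alpha t) (gamma s) = zero).
{ apply C2_ext; [change (@eq C (fst (C2_derive alpha t) * fst (gamma s))%C (RtoC 0))
    | change (@eq C (snd (C2_derive alpha t) * snd (gamma s))%C (RtoC 0))].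
  - rewrite (root _ g0); apply Cmult_0_r.
  - rewrite (root _ (eq_trans A2 a0)); apply Cmult_0_l. }
destruct (Himm t s Ht Hs 1 0) as [H _]; [| lra].
rewrite Dt, E.
exact (eq_trans (f_equal2 plus (scal_zero_r (V := C2) _) (scal_zero_l (V := C2) _))
  (plus_zero_l (G := C2) zero)).
Qed.

(** The terms [conj (moment alpha t)] and [conj (moment gamma s)] of
    [phi_second_products] cancel in the Laplacian of [phi]. *)
Lemma phi_mean_curvature (I J : R -> Prop) (alpha gamma : R -> C2) (t s : R) :
  open I -> open J -> legendre (-1) I alpha -> legendre 1 J gamma ->
  immersion I J (phi alpha gamma) -> I t -> J s ->
  let W := sqnorm1 alpha t + sqnorm1 gamma s in
  mean_curvature (phi alpha gamma) t s =
  plus (cscal (0, curvature (-1) alpha t / (2 * W)) (D_t (phi alpha gamma) t s))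
       (cscal (0, curvature 1 gamma s / (2 * W)) (D_s (phi alpha gamma) t s)).
Proof.
intros HI HJ Ha Hg Himm Ht Hs W.
destruct (phi_first_derivatives I J alpha gamma t s (proj1 Ha) (proj1 Hg) Ht Hs) as [Dt Ds].
destruct (phi_second_derivatives I J alpha gamma t s HI HJ (proj1 Ha) (proj1 Hg) Ht Hs)
  as (Dtt & _ & _ & Dss).
assert (Ett := C2_derive_correct _ _ _ Dtt : D_t (D_t (phi alpha gamma)) t s = _).
assert (Ess := C2_derive_correct _ _ _ Dss : D_s (D_s (phi alpha gamma)) t s = _).
destruct (phi_second_products I J alpha gamma t s HI HJ Ha Hg Ht Hs)
  as (P1 & P2 & _ & _ & P5 & P6).
apply mean_curvature_frame.
- rewrite Dt, Ds; exact (phi_conformal_frame I J alpha gamma t s Ha Hg Himm Ht Hs).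
- rewrite Ett, Ess, Dt, P1, P5; fold W.
  destruct (moment alpha t); unfold RtoC, Im; cbn; ring.
- rewrite Ett, Ess, Ds, P2, P6; fold W.
  destruct (moment gamma s); unfold RtoC, Im; cbn; ring.
Qed.

(** The equations for the tangent field [J H], whose dual one-form is
    [- (p dt + q ds) / 2], to be parallel for the metric [W (dt^2 + ds^2)]; they
    are obtained by testing the flat derivatives of [H] against [phi_t] and
    [phi_s]. *)
Lemma phi_parallel_iff (I J : R -> Prop) (alpha gamma : R -> C2) :
  open I -> open J -> legendre (-1) I alpha -> legendre 1 J gamma ->
  immersion I J (phi alpha gamma) ->
  let p := curvature (-1) alpha in
  let q := curvature 1 gamma in
  let W t s := sqnorm1 alpha t + sqnorm1 gamma s in
  normal_parallel (phi alpha gamma) I J (mean_curvature (phi alpha gamma)) <->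
  forall t s, I t -> J s ->
    q s * Re (moment alpha t) + p t * Re (moment gamma s) = 0 /\
    W t s * Derive p t = p t * Re (moment alpha t) - q s * Re (moment gamma s) /\
    W t s * Derive q s = q s * Re (moment gamma s) - p t * Re (moment alpha t).
Proof.
intros HI HJ Ha Hg Himm p q W.
assert (main : forall t s, I t -> J s ->
  (normal_part (phi alpha gamma) t s (D_t (mean_curvature (phi alpha gamma)) t s) = zero /\
   normal_part (phi alpha gamma) t s (D_s (mean_curvature (phi alpha gamma)) t s) = zero) <->
  (q s * Re (moment alpha t) + p t * Re (moment gamma s) = 0 /\
    W t s * Derive p t = p t * Re (moment alpha t) - q s * Re (moment gamma s) /\
    W t s * Derive q s = q s * Re (moment gamma s) - p t * Re (moment alpha t))).
2: { split; intros H t s Ht Hs; apply (main t s Ht Hs), H; assumption. }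
intros t s Ht Hs.
destruct (phi_first_derivatives I J alpha gamma t s (proj1 Ha) (proj1 Hg) Ht Hs) as [Dt Ds].
destruct (phi_second_derivatives I J alpha gamma t s HI HJ (proj1 Ha) (proj1 Hg) Ht Hs)
  as (Dtt & Dts & Dst & Dss).
assert (HF := phi_conformal_frame I J alpha gamma t s Ha Hg Himm Ht Hs).
fold (W t s) in HF; assert (HW : W t s <> 0) by exact (proj1 HF).
assert (HF' : conformal_frame (W t s) (D_t (phi alpha gamma) t s) (D_s (phi alpha gamma) t s))
  by (rewrite Dt, Ds; exact HF).
assert (HH := fun t s => phi_mean_curvature I J alpha gamma t s HI HJ Ha Hg Himm).
fold p q in HH; change (forall t s, I t -> J s -> mean_curvature (phi alpha gamma) t s =
  plus (cscal (0, p t / (2 * W t s)) (D_t (phi alpha gamma) t s))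
       (cscal (0, q s / (2 * W t s)) (D_s (phi alpha gamma) t s))) in HH.
assert (dp := curvature_derive _ I alpha t Ha Ht : is_derive p t (Derive p t)).
assert (dq := curvature_derive _ J gamma s Hg Hs : is_derive q s (Derive q s)).
assert (dWt : is_derive (fun u => W u s) t (2 * Re (moment alpha t)))
  by exact (proj1 (is_derive_plus_const _ _ _ (sqnorm1 gamma s) (sqnorm1_derive _ I alpha t Ha Ht))).
assert (dWs : is_derive (fun u => W t u) s (2 * Re (moment gamma s)))
  by exact (proj2 (is_derive_plus_const _ _ _ (sqnorm1 alpha t) (sqnorm1_derive _ J gamma s Hg Hs))).
assert (cst : forall k x, is_derive (fun _ : R => k) x 0)
  by (intros; apply (@is_derive_const R_AbsRing R_NormedModule)).
assert (Ht' := is_C2_derive_plus _ _ _ _ _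
  (is_C2_derive_cscal _ _ _ _ _ (is_derive_half_quot p (fun u => W u s) t _ _ dp dWt HW) Dtt)
  (is_C2_derive_cscal _ _ _ _ _
     (is_derive_half_quot (fun _ => q s) (fun u => W u s) t _ _ (cst _ _) dWt HW) Dts)).
assert (Hs' := is_C2_derive_plus _ _ _ _ _
  (is_C2_derive_cscal _ _ _ _ _
     (is_derive_half_quot (fun _ => p t) (fun u => W t u) s _ _ (cst _ _) dWs HW) Dst)
  (is_C2_derive_cscal _ _ _ _ _ (is_derive_half_quot q (fun u => W t u) s _ _ dq dWs HW) Dss)).
apply (D_t_of_local (mean_curvature (phi alpha gamma)) _ t s) in Ht'.
2: { apply (filter_imp I); [| exact (HI t Ht)].
     intros u Hu; symmetry; exact (HH u s Hu Hs). }
apply (D_s_of_local (mean_curvature (phi alpha gamma)) _ t s) in Hs'.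
2: { apply (filter_imp J); [| exact (HJ s Hs)].
     intros u Hu; symmetry; exact (HH t u Ht Hu). }
rewrite !(normal_part_eq_0 _ t s (W t s) _ HF').
rewrite Ht', Hs'; cbv beta; rewrite Dt, Ds.
destruct (phi_second_products I J alpha gamma t s HI HJ Ha Hg Ht Hs)
  as (P1 & P2 & P3 & P4 & P5 & P6).
destruct HF as (_ & PX & PY & PXY & PYX).
rewrite !herm_plus_l, !herm_cscal_l, P1, P2, P3, P4, P5, P6, PX, PY, PXY, PYX.
fold (W t s).
destruct (moment alpha t) as [za ya], (moment gamma s) as [zg yg]; cbn [Re fst].
set (w := W t s) in *; clearbody w.
set (p' := Derive p t); set (q' := Derive q s); set (p0 := p t); set (q0 := q s).
match goal with |- (?a = 0 /\ ?b = 0) /\ (?c = 0 /\ ?d = 0) <-> _ =>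
  replace a with ((w * p' - (p0 * za - q0 * zg)) / (2 * w))
    by (unfold RtoC, Im; cbn; field; exact HW);
  replace b with (- (q0 * za + p0 * zg) / (2 * w))
    by (unfold RtoC, Im; cbn; field; exact HW);
  replace c with (- (q0 * za + p0 * zg) / (2 * w))
    by (unfold RtoC, Im; cbn; field; exact HW);
  replace d with ((w * q' - (q0 * zg - p0 * za)) / (2 * w))
    by (unfold RtoC, Im; cbn; field; exact HW)
end.
assert (quot : forall x, x / (2 * w) = 0 <-> x = 0).
{ intros x; split; [intros E | intros ->; field; exact HW].
  transitivity (x / (2 * w) * (2 * w)); [field; exact HW | rewrite E; ring]. }
rewrite !quot; clear; intuition lra.
Qed.

Lemma phi_mean_curvature_eq_0 (I J : R -> Prop) (alpha gamma : R -> C2) (t s : R) :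
  open I -> open J -> legendre (-1) I alpha -> legendre 1 J gamma ->
  immersion I J (phi alpha gamma) -> I t -> J s ->
  (mean_curvature (phi alpha gamma) t s = zero <->
   curvature (-1) alpha t = 0 /\ curvature 1 gamma s = 0).
Proof.
intros HI HJ Ha Hg Himm Ht Hs.
rewrite (phi_mean_curvature I J alpha gamma t s HI HJ Ha Hg Himm Ht Hs).
destruct (phi_first_derivatives I J alpha gamma t s (proj1 Ha) (proj1 Hg) Ht Hs) as [-> ->].
assert (HF := phi_conformal_frame I J alpha gamma t s Ha Hg Himm Ht Hs).
set (W := sqnorm1 alpha t + sqnorm1 gamma s) in *; clearbody W.
pose proof HF as (HW & PX & PY & PXY & PYX).
set (X := cprod (C2_derive alpha t) (gamma s)) in *.
set (Y := cprod (alpha t) (C2_derive gamma s)) in *.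
set (p := curvature (-1) alpha t); set (q := curvature 1 gamma s); clearbody p q.
split.
- intros E.
  assert (EX := f_equal (fun v => Im (herm 1 v X)) E).
  assert (EY := f_equal (fun v => Im (herm 1 v Y)) E).
  cbv beta in EX, EY.
  rewrite herm_zero_l, herm_plus_l, !herm_cscal_l, PX, PYX in EX.
  rewrite herm_zero_l, herm_plus_l, !herm_cscal_l, PXY, PY in EY.
  unfold RtoC, Cmult, Cplus in EX, EY; cbn in EX, EY.
  split.
  + apply (Rmult_eq_reg_l (/ 2)); [| lra].
    rewrite Rmult_0_r; refine (eq_trans _ EX); field; exact HW.
  + apply (Rmult_eq_reg_l (/ 2)); [| lra].
    rewrite Rmult_0_r; refine (eq_trans _ EY); field; exact HW.
- intros [-> ->]; apply (conformal_frame_ext W X Y _ _ HF);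
    rewrite herm_zero_l, herm_plus_l, !herm_cscal_l, ?PX, ?PY, ?PXY, ?PYX;
    unfold RtoC, Cmult, Cplus; cbn; f_equal; field; exact HW.
Qed.

(** * The differential equations of a parallel mean curvature vector *)

Lemma open_Rbar_interval (a b : Rbar) : open (Rbar_interval a b).
Proof. apply open_and; [apply open_Rbar_gt | apply open_Rbar_lt]. Qed.

Lemma Rbar_interval_inhabited (a b : Rbar) :
  Rbar_lt a b -> exists x, Rbar_interval a b x.
Proof.
unfold Rbar_interval; destruct a as [a | |], b as [b | |]; cbn; try easy; intros H.
- exists ((a + b) / 2); lra.
- exists (a + 1); split; [lra | exact Logic.I].
- exists (b - 1); split; [exact Logic.I | lra].
- exists 0; split; exact Logic.I.
Qed.

Lemma Rbar_interval_convex (a b : Rbar) (x y z : R) :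
  Rbar_interval a b x -> Rbar_interval a b y -> x <= z <= y -> Rbar_interval a b z.
Proof.
intros [Hx _] [_ Hy] [H1 H2]; split;
  [apply (Rbar_lt_le_trans a x z) | apply (Rbar_le_lt_trans z y b)]; assumption.
Qed.

Lemma derive_0_constant (a b : Rbar) (f : R -> R) (x y : R) :
  (forall z, Rbar_interval a b z -> is_derive f z 0) ->
  Rbar_interval a b x -> Rbar_interval a b y -> f x = f y.
Proof.
intros H Hx Hy.
assert (mono : forall u v, Rbar_interval a b u -> Rbar_interval a b v -> u < v -> f u = f v).
{ intros u v Hu Hv Huv; apply (eq_is_derive f u v); [| exact Huv].
  intros z Hz; apply H; exact (Rbar_interval_convex a b u v z Hu Hv Hz). }
destruct (Rtotal_order x y) as [L | [-> | L]]; auto; symmetry; auto.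
Qed.

(** Writing [q], [x], [y] for the curvature, [|gamma_1|^2] and the imaginary
    part of the moment, the assumed form [- c M q] of the real part and its
    derivative [1 - 2 x - q y] give [1 - 2 x - q y = c^2 M].  Differentiating
    once more gives [y = - M (4 q + q^3)], and once more
    [4 c M (1 + q^2) = 0]. *)
Lemma curvature_not_affine (J : R -> Prop) (gamma : R -> C2) (s0 c M : R) :
  open J -> legendre 1 J gamma -> J s0 -> c <> 0 -> M <> 0 ->
  (forall s, J s -> is_derive (curvature 1 gamma) s (- c)) ->
  (forall s, J s -> Re (moment gamma s) = - c * M * curvature 1 gamma s) -> False.
Proof.
intros HJ Hg Hs0 Hc HM Dq Hz.
set (q := curvature 1 gamma) in *.
set (x := sqnorm1 gamma); set (z := fun s => Re (moment gamma s)); set (y := fun s => Im (moment gamma s)).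
assert (Dx : forall s, J s -> is_derive x s (2 * z s))
  by (intros s Hs; exact (sqnorm1_derive 1 J gamma s Hg Hs)).
assert (Dz : forall s, J s -> is_derive z s (1 - 2 * 1 * x s - q s * y s))
  by (intros s Hs; exact (proj1 (moment_derive 1 J gamma s (Rmult_1_l 1) HJ Hg Hs))).
assert (Dy : forall s, J s -> is_derive y s (q s * z s))
  by (intros s Hs; exact (proj2 (moment_derive 1 J gamma s (Rmult_1_l 1) HJ Hg Hs))).
assert (E1 : forall s, J s -> 1 - 2 * 1 * x s - q s * y s = - c * M * - c).
{ intros s Hs.
  apply (derive_eq_on_open J z (fun s => - c * M * q s) s _ _ HJ Hs Hz (Dz s Hs)).
  exact (is_derive_scal q s (- c * M) (- c) (Dq s Hs)). }
assert (E2 : forall s, J s -> y s = - M * (4 * q s + q s ^ 3)).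
{ intros s Hs.
  assert (D := derive_eq_on_open J (fun s => 1 - 2 * 1 * x s - q s * y s)
    (fun _ => - c * M * - c) s (0 - 2 * 1 * (2 * z s) - (- c * y s + q s * (q s * z s))) 0 HJ Hs E1).
  assert (Eq : 0 - 2 * 1 * (2 * z s) - (- c * y s + q s * (q s * z s)) = 0).
  { apply D; [| apply (@is_derive_const R_AbsRing R_NormedModule)].
    exact (@is_derive_minus R_AbsRing R_NormedModule _ _ _ _ _
      (@is_derive_minus R_AbsRing R_NormedModule _ _ _ _ _ (is_derive_const 1 s)
         (is_derive_scal x s (2 * 1) _ (Dx s Hs)))
      (is_derive_Rmult _ _ _ _ _ (Dq s Hs) (Dy s Hs))). }
  unfold z in Eq; rewrite (Hz s Hs) in Eq.
  apply (Rmult_eq_reg_l c); [| exact Hc].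
  transitivity (c * y s - (0 - 2 * 1 * (2 * (- c * M * q s)) -
     (- c * y s + q s * (q s * (- c * M * q s))))); [rewrite Eq; ring | ring]. }
assert (E3 : q s0 * z s0 = - M * (4 * - c + 3 * q s0 ^ 2 * - c)).
{ apply (derive_eq_on_open J y (fun s => - M * (4 * q s + q s ^ 3)) s0 _ _ HJ Hs0 E2 (Dy s0 Hs0)).
  apply is_derive_scal.
  replace (3 * q s0 ^ 2 * - c) with (INR 3 * - c * q s0 ^ 2) by (simpl; ring).
  exact (@is_derive_plus R_AbsRing R_NormedModule _ _ _ _ _
    (is_derive_scal q s0 4 _ (Dq s0 Hs0)) (is_derive_pow q 3 s0 _ (Dq s0 Hs0))). }
unfold z in E3; rewrite (Hz s0 Hs0) in E3.
assert (E4 : c * M * (1 + q s0 ^ 2) = 0) by lra.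
apply Rmult_integral in E4 as [E4 | E4]; [| nra].
apply Rmult_integral in E4 as [E4 | E4]; contradiction.
Qed.

(** The real part of the moment vanishes, so its derivative gives
    [k y = 1 - 2 e |c_1|^2] with [y] the imaginary part; as [y' = 0], one
    more differentiation gives [k' y = 0].  If [y] were [0], then
    [e |c_1|^2 = 1 / 2], but the square modulus of the moment is
    [|c_1|^2 (1 - e |c_1|^2)], which would be nonzero. *)
Lemma constant_sqnorm1_curvature (e : R) (I : R -> Prop) (c : R -> C2) :
  e * e = 1 -> open I -> legendre e I c ->
  constant_on I (fun x => Cmod (fst (c x))) ->
  forall x, I x ->
    Re (moment c x) = 0 /\ Derive (curvature e c) x = 0 /\
    curvature e c x * Im (moment c x) = 1 - 2 * e * sqnorm1 c x.
Proof.
intros He HI HL [r Hr].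
assert (Z : forall x, I x -> Re (moment c x) = 0).
{ intros x Hx.
  assert (E : 2 * Re (moment c x) = 0); [| lra].
  apply (derive_eq_on_open I (sqnorm1 c) (fun _ => r ^ 2) x _ _ HI Hx).
  - intros y Hy; unfold sqnorm1; rewrite (Hr y Hy); reflexivity.
  - exact (sqnorm1_derive e I c x HL Hx).
  - apply (@is_derive_const R_AbsRing R_NormedModule). }
assert (K : forall x, I x -> curvature e c x * Im (moment c x) = 1 - 2 * e * r ^ 2).
{ intros x Hx.
  assert (E : 1 - 2 * e * sqnorm1 c x - curvature e c x * Im (moment c x) = 0).
  { apply (derive_eq_on_open I _ (fun _ => 0) x _ _ HI Hx Z).
    - exact (proj1 (moment_derive e I c x He HI HL Hx)).
    - apply (@is_derive_const R_AbsRing R_NormedModule). }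
  unfold sqnorm1 in E; rewrite (Hr x Hx) in E; lra. }
intros x Hx; split; [exact (Z x Hx) | split].
2: { unfold sqnorm1; rewrite (Hr x Hx); exact (K x Hx). }
assert (E : Derive (curvature e c) x * Im (moment c x) +
  curvature e c x * (curvature e c x * Re (moment c x)) = 0).
{ apply (derive_eq_on_open I _ (fun _ => 1 - 2 * e * r ^ 2) x _ _ HI Hx K).
  - exact (is_derive_Rmult _ _ _ _ _ (curvature_derive e I c x HL Hx)
      (proj2 (moment_derive e I c x He HI HL Hx))).
  - apply (@is_derive_const R_AbsRing R_NormedModule). }
rewrite (Z x Hx) in E.
assert (Hy : Im (moment c x) <> 0).
{ intros Hy; assert (S := moment_sqnorm e I c x He HL Hx); assert (Kx := K x Hx).
  unfold sqnorm1 in S; rewrite (Hr x Hx), (Z x Hx), Hy in S; rewrite Hy in Kx.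
  assert (er : e * r ^ 2 = 1 / 2) by lra.
  rewrite er in S; assert (r0 : r ^ 2 = 0) by lra.
  rewrite r0 in er; lra. }
apply (Rmult_eq_reg_r (Im (moment c x))); [lra | exact Hy].
Qed.

(** The first two equations form a linear system for the two real parts, with
    determinant [- (p^2 + q^2)]; comparing the last two shows that [q' = - c] with
    [c = p'(t0)]. *)
Lemma parallel_moments_vanish (a b : Rbar) (I : R -> Prop) (alpha gamma : R -> C2) (t0 : R) :
  open I -> legendre (-1) I alpha -> legendre 1 (Rbar_interval a b) gamma -> I t0 ->
  (forall t s, I t -> Rbar_interval a b s ->
    sqnorm1 alpha t + sqnorm1 gamma s <> 0) ->
  (forall t s, I t -> Rbar_interval a b s ->
    ~ (curvature (-1) alpha t = 0 /\ curvature 1 gamma s = 0)) ->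
  (forall t s, I t -> Rbar_interval a b s ->
    curvature 1 gamma s * Re (moment alpha t) + curvature (-1) alpha t * Re (moment gamma s) = 0 /\
    (sqnorm1 alpha t + sqnorm1 gamma s) * Derive (curvature (-1) alpha) t =
      curvature (-1) alpha t * Re (moment alpha t) - curvature 1 gamma s * Re (moment gamma s) /\
    (sqnorm1 alpha t + sqnorm1 gamma s) * Derive (curvature 1 gamma) s =
      curvature 1 gamma s * Re (moment gamma s) - curvature (-1) alpha t * Re (moment alpha t)) ->
  forall s, Rbar_interval a b s -> Re (moment alpha t0) = 0 /\ Re (moment gamma s) = 0.
Proof.
intros HI Ha Hg Ht0 HW Hnz Hpar s0 Hs0.
set (J := Rbar_interval a b) in *; assert (HJ : open J) by apply open_Rbar_interval.
set (p0 := curvature (-1) alpha t0) in *.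
set (q := curvature 1 gamma) in *.
set (c := Derive (curvature (-1) alpha) t0).
set (za := Re (moment alpha t0)).
set (W := fun s => sqnorm1 alpha t0 + sqnorm1 gamma s).
set (n := fun s => p0 ^ 2 + q s ^ 2).
assert (Hn : forall s, J s -> n s <> 0).
{ intros s Hs E; apply (Hnz t0 s Ht0 Hs); fold p0; fold q; unfold n in E; split; nra. }
assert (Dq : forall s, J s -> is_derive q s (- c)).
{ intros s Hs; replace (- c) with (Derive q s); [exact (curvature_derive _ _ _ _ Hg Hs) |].
  destruct (Hpar t0 s Ht0 Hs) as (_ & E2 & E3); fold p0 q c in E2, E3.
  apply (Rmult_eq_reg_l (sqnorm1 alpha t0 + sqnorm1 gamma s)); [| exact (HW t0 s Ht0 Hs)].
  lra. }
assert (Eg : forall s, J s -> Re (moment gamma s) * n s = - c * W s * q s).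
{ intros s Hs; destruct (Hpar t0 s Ht0 Hs) as (E1 & E2 & _); fold p0 q c za in E1, E2.
  fold (W s) in E2; unfold n.
  transitivity (p0 * (q s * za + p0 * Re (moment gamma s)) -
    q s * (p0 * za - q s * Re (moment gamma s))); [ring |].
  rewrite E1, <- E2; ring. }
assert (Ea : forall s, J s -> za * n s = c * W s * p0).
{ intros s Hs; destruct (Hpar t0 s Ht0 Hs) as (E1 & E2 & _); fold p0 q c za in E1, E2.
  fold (W s) in E2; unfold n.
  transitivity (q s * (q s * za + p0 * Re (moment gamma s)) +
    p0 * (p0 * za - q s * Re (moment gamma s))); [ring |].
  rewrite E1, <- E2; ring. }
destruct (Req_dec c 0) as [Hc | Hc].
- split; apply (Rmult_eq_reg_r (n s0)); try exact (Hn s0 Hs0).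
  + rewrite Rmult_0_l; fold za; rewrite (Ea s0 Hs0), Hc; ring.
  + rewrite Rmult_0_l, (Eg s0 Hs0), Hc; ring.
- exfalso.
  (* W' = 2 Re (moment gamma) and (q^2)' = - 2 c q, which cancel by [Eg] *)
  assert (DM : forall s, J s -> is_derive (fun s => W s / n s) s 0).
  { intros s Hs.
    assert (DW : is_derive W s (2 * Re (moment gamma s)))
      by exact (proj2 (is_derive_plus_const _ _ _ _ (sqnorm1_derive _ J gamma s Hg Hs))).
    assert (Dn : is_derive n s (INR 2 * - c * q s ^ 1))
      by exact (proj2 (is_derive_plus_const _ _ _ (p0 ^ 2) (is_derive_pow q 2 s _ (Dq s Hs)))).
    replace 0 with ((2 * Re (moment gamma s) * n s - W s * (INR 2 * - c * q s ^ 1)) / n s ^ 2).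
    - exact (is_derive_div W n s _ _ DW Dn (Hn s Hs)).
    - rewrite Rmult_assoc, (Eg s Hs); simpl; field; exact (Hn s Hs). }
  apply (curvature_not_affine J gamma s0 c (W s0 / n s0) HJ Hg Hs0 Hc).
  + intros E; apply (HW t0 s0 Ht0 Hs0); fold (W s0).
    transitivity (W s0 / n s0 * n s0); [field; exact (Hn s0 Hs0) | rewrite E; ring].
  + exact Dq.
  + intros s Hs; fold q.
    assert (E := derive_0_constant a b (fun s => W s / n s) s0 s DM Hs0 Hs).
    cbv beta in E; rewrite E.
    apply (Rmult_eq_reg_r (n s)); [| exact (Hn s Hs)].
    rewrite (Eg s Hs); field; exact (Hn s Hs).
Qed.

Lemma moment_vanish_constant (e : R) (a b : Rbar) (c : R -> C2) :
  Rbar_lt a b -> legendre e (Rbar_interval a b) c ->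
  (forall x, Rbar_interval a b x -> Re (moment c x) = 0) ->
  constant_on (Rbar_interval a b) (fun x => Cmod (fst (c x))).
Proof.
intros Hab HL Z; destruct (Rbar_interval_inhabited a b Hab) as [x0 Hx0].
exists (Cmod (fst (c x0))); intros x Hx.
assert (E : sqnorm1 c x = sqnorm1 c x0).
{ apply (derive_0_constant a b); [| exact Hx | exact Hx0].
  intros y Hy; replace 0 with (2 * Re (moment c y)) by (rewrite (Z y Hy); ring).
  exact (sqnorm1_derive e _ c y HL Hy). }
unfold sqnorm1 in E; rewrite <- !Rsqr_pow2 in E.
apply Rsqr_inj; [apply Cmod_ge_0 | apply Cmod_ge_0 | exact E].
Qed.

Theorem theorem4p2 (a1 b1 a2 b2 : Rbar)
    (hI1 : Rbar_lt a1 b1) (hI2 : Rbar_lt a2 b2)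
    (gamma alpha : R -> C2)
    (hgamma : unit_speed_legendre_S3 (Rbar_interval a1 b1) gamma)
    (halpha : unit_speed_legendre_H31 (Rbar_interval a2 b2) alpha)
    (himm : immersion (Rbar_interval a2 b2) (Rbar_interval a1 b1) (phi alpha gamma)) :
  (normal_parallel (phi alpha gamma) (Rbar_interval a2 b2) (Rbar_interval a1 b1)
     (mean_curvature (phi alpha gamma)) /\
   forall t s : R, Rbar_interval a2 b2 t -> Rbar_interval a1 b1 s ->
     mean_curvature (phi alpha gamma) t s <> zero)
  <->
  (constant_on (Rbar_interval a1 b1) (fun s => Cmod (fst (gamma s))) /\
   constant_on (Rbar_interval a2 b2) (fun t => Cmod (fst (alpha t)))).
Proof.
assert (Hg := S3_legendre _ _ hgamma); assert (Ha := H31_legendre _ _ halpha).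
assert (HI := open_Rbar_interval a2 b2); assert (HJ := open_Rbar_interval a1 b1).
rewrite (phi_parallel_iff _ _ alpha gamma HI HJ Ha Hg himm).
assert (HH := fun t s => phi_mean_curvature_eq_0 _ _ alpha gamma t s HI HJ Ha Hg himm).
split.
- intros [Hpar Hnz].
  assert (Z : forall t s, Rbar_interval a2 b2 t -> Rbar_interval a1 b1 s ->
    Re (moment alpha t) = 0 /\ Re (moment gamma s) = 0).
  { intros t s Ht Hs.
    apply (parallel_moments_vanish a1 b1 (Rbar_interval a2 b2)); try assumption.
    - intros t' s' Ht' Hs'.
      exact (proj1 (phi_conformal_frame _ _ alpha gamma t' s' Ha Hg himm Ht' Hs')).
    - intros t' s' Ht' Hs' E; exact (Hnz t' s' Ht' Hs' (proj2 (HH t' s' Ht' Hs') E)). }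
  destruct (Rbar_interval_inhabited a1 b1 hI1) as [s0 Hs0].
  destruct (Rbar_interval_inhabited a2 b2 hI2) as [t0 Ht0].
  split.
  + apply (moment_vanish_constant 1 a1 b1 gamma hI1 Hg); intros s Hs; apply (Z t0 s Ht0 Hs).
  + apply (moment_vanish_constant (-1) a2 b2 alpha hI2 Ha); intros t Ht; apply (Z t s0 Ht Hs0).
- intros [Cg Ca].
  assert (m1 : (-1) * (-1) = 1) by ring.
  assert (Kg := constant_sqnorm1_curvature 1 _ gamma (Rmult_1_l 1) HJ Hg Cg).
  assert (Ka := constant_sqnorm1_curvature (-1) _ alpha m1 HI Ha Ca).
  split.
  + intros t s Ht Hs.
    destruct (Kg s Hs) as (-> & -> & _), (Ka t Ht) as (-> & -> & _).
    split; [| split]; ring.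
  + intros t s Ht Hs E; apply (HH t s Ht Hs) in E as [E _].
    destruct (Ka t Ht) as (_ & _ & K); rewrite E in K.
    assert (0 <= sqnorm1 alpha t) by apply pow2_ge_0; lra.
Qed.
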